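(* Let $\mathscr{C}=\{(x,y,z)\in\mathbb{R}^3: x,y,z\ge 0,\ z\le x+y\}$. In generalized non-signalling theory (box world), every vector in $\mathscr{C}$ lies in the closure of the set of bipartite entropy vectors $(\hat H(X),\hat H(Y),\hat H(XY))$, where $X$, $Y$ range over systems of finitely many boxes and the state ranges over all states of the joint system $XY$.
   Context: Box world (GNST): a box has a finite set of inputs and outputs (a box with a single input is called classical). A system of boxes has states given by all collections $p(\mathbf{a}|\mathbf{x})\ge0$ (output tuple $\mathbf{a}$, input tuple $\mathbf{x}$) that are normalized ($\sum_{\mathbf{a}}p(\mathbf{a}|\mathbf{x})=1$) and no-signalling (for each box $i$, $\sum_{a_i}p(\mathbf{a}|\mathbf{x})$ is independent of $x_i$); reduced states are obtained by summing out the outputs of the discarded boxes. An effect is any linear map from states to $[0,1]$; a measurement is a finite set $\{(r,\mu_r)\}$ of effects summing to the constant map $1$ (all such are allowed). A measurement $N=\{(s,\nu_s)\}$ refines $M=\{(r,\mu_r)\}$ if the outcomes of $N$ can be partitioned into sets $P_r$ with $\mu_r=\sum_{s\in P_r}\nu_s$; the refinement is trivial if $\nu_s\propto\mu_r$ whenever $s\in P_r$; $M$ is maximally informative if it has no non-trivial refinement. The measurement entropy of a system $Z$ in state $\mathbf{p}$ is $\hat H(Z)=\inf_M H_M(Z)$, the infimum over maximally informative measurements $M$ on $Z$ of the Shannon entropy (base 2) of the outcome distribution $(\mu_r(\mathbf{p}))_r$. For a state of $XY$, $\hat H(X)$ and $\hat H(Y)$ are evaluated on the reduced states. *)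

(* Defs.v *)
From HB Require Import structures.
From mathcomp Require Import all_boot all_order all_algebra.
From mathcomp Require Import all_classical all_reals all_analysis.
Set Implicit Arguments. Unset Strict Implicit. Unset Printing Implicit Defensive.
Import Order.TTheory GRing.Theory Num.Theory.
Local Open Scope ring_scope.
Local Open Scope classical_set_scope.

(* A system of boxes is given by a finite type B of boxes, and for each box b
   the number of inputs (kin b).+1 and of outputs (kout b).+1
   (inputs of b are 'I_(kin b).+1, outputs 'I_(kout b).+1). *)

Definition Inp (B : finType) (kin : B -> nat) := {dffun forall b : B, 'I_(kin b).+1}.
Definition Out (B : finType) (kout : B -> nat) := {dffun forall b : B, 'I_(kout b).+1}.

Section BoxWorld.
Variable R : realType.
Variable B : finType.
Variables kin kout : B -> nat.

Definition bvec := Out kout -> Inp kin -> R.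

Definition is_state (p : bvec) : Prop :=
  [/\ (forall a x, 0 <= p a x),
      (forall x, \sum_(a : Out kout) p a x = 1) &
      (forall (i : B) (x x' : Inp kin), (forall j, j != i -> x j = x' j) ->
         forall a : Out kout,
           \sum_(a' : Out kout | [forall j, (j != i) ==> (a' j == a j)]) p a' x =
           \sum_(a' : Out kout | [forall j, (j != i) ==> (a' j == a j)]) p a' x')].

Definition eval (c p : bvec) : R := \sum_(a : Out kout) \sum_(x : Inp kin) c a x * p a x.

Definition is_effect (c : bvec) : Prop :=
  forall p, is_state p -> 0 <= eval c p <= 1.

Definition is_meas (n : nat) (mu : 'I_n -> bvec) : Prop :=
  (forall r, is_effect (mu r)) /\
  (forall p, is_state p -> \sum_(r < n) eval (mu r) p = 1).

(* N = (m, nu) refines M = (n, mu) via the partition of outcomes given by f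
   (P_r = f^-1 r); equalities of effects are equalities of maps on states *)
Definition refines_via (n : nat) (mu : 'I_n -> bvec) (m : nat) (nu : 'I_m -> bvec)
  (f : 'I_m -> 'I_n) : Prop :=
  forall (r : 'I_n) p, is_state p ->
    eval (mu r) p = \sum_(s < m | f s == r) eval (nu s) p.

Definition trivial_refinement (n : nat) (mu : 'I_n -> bvec) (m : nat) (nu : 'I_m -> bvec)
  (f : 'I_m -> 'I_n) : Prop :=
  forall s : 'I_m, exists c : R, forall p, is_state p ->
    eval (nu s) p = c * eval (mu (f s)) p.

Definition max_informative (n : nat) (mu : 'I_n -> bvec) : Prop :=
  is_meas mu /\
  forall (m : nat) (nu : 'I_m -> bvec) (f : 'I_m -> 'I_n),
    is_meas nu -> refines_via mu nu f -> trivial_refinement mu nu f.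

Definition shannon (n : nat) (q : 'I_n -> R) : R :=
  - \sum_(r < n) (if 0 < q r then q r * (ln (q r) / ln 2) else 0).

Definition meas_entropy (p : bvec) : R :=
  inf [set h : R | exists (n : nat) (mu : 'I_n -> bvec),
         max_informative mu /\ h = shannon (fun r => eval (mu r) p)].

End BoxWorld.

Definition sumk (BX BY : finType) (kX : BX -> nat) (kY : BY -> nat) : (BX + BY)%type -> nat :=
  fun i => match i with inl b => kX b | inr b => kY b end.

Section Joint.
Variable R : realType.
Variables BX BY : finType.
Variables (kX oX : BX -> nat) (kY oY : BY -> nat).

Definition inpL (x : Inp kX) : Inp (sumk kX kY) :=
  finfun (fun i => match i as i0 return 'I_(sumk kX kY i0).+1 with
                   | inl b => x b | inr b => ord0 end).
Definition inpR (y : Inp kY) : Inp (sumk kX kY) :=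
  finfun (fun i => match i as i0 return 'I_(sumk kX kY i0).+1 with
                   | inl b => ord0 | inr b => y b end).

(* reduced states (the inputs of the discarded boxes are set to 0, which is
   immaterial by no-signalling) *)
Definition margX (p : bvec R (sumk kX kY) (sumk oX oY)) : bvec R kX oX :=
  fun a x => \sum_(a' : Out (sumk oX oY) | [forall b, a' (inl b) == a b :> nat]) p a' (inpL x).
Definition margY (p : bvec R (sumk kX kY) (sumk oX oY)) : bvec R kY oY :=
  fun a y => \sum_(a' : Out (sumk oX oY) | [forall b, a' (inr b) == a b :> nat]) p a' (inpR y).

End Joint.

Definition entropy_vectors (R : realType) : set (R * R * R) :=
  [set v | exists (n m : nat) (kX oX : 'I_n -> nat) (kY oY : 'I_m -> nat)
             (p : bvec R (sumk kX kY) (sumk oX oY)),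
             is_state p /\
             v = (meas_entropy (margX p), meas_entropy (margY p), meas_entropy p)].

Definition coneC (R : realType) : set (R * R * R) :=
  [set v | 0 <= v.1.1 /\ 0 <= v.1.2 /\ 0 <= v.2 /\ v.2 <= v.1.1 + v.1.2].

Arguments coneC R : clear implicits.
Arguments entropy_vectors R : clear implicits.

(* Main.v *)
(** Up to functionals vanishing on states, Farkas' lemma makes every effect of a
    system of boxes a nonnegative combination of the effects p |-> p(a|x).  Hence
    each outcome of a maximally informative measurement is c p(a|x) with
    0 <= c <= 1, so its entropy is at least the average of - log2 p(a|x);
    conversely every adaptive choice of inputs is maximally informative.

    Given (x, y, z) with z <= x + y, write z = z1 + z2 with z1 <= x, z2 <= y.
    With probability 1 - 1/M^2 all outputs are 0.  Otherwise X holds a box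
    revealing a random key i among M and a second box revealing M^2 z1 random
    bits, and M^2 (x - z1) further ones unless its input is the key j of Y; Y is
    symmetric, with z2 and y - z2.  A party alone guesses the other key with
    probability 1/M only and hence sees entropy close to x (resp. y), whereas
    jointly the keys can be read first and used as inputs, which leaves only
    z1 + z2 = z.  Keys and idling contribute O(log M / M^2). *)
Require Import Defs.
From HB Require Import structures.
From mathcomp Require Import all_boot all_order all_algebra.
From mathcomp Require Import all_classical all_reals all_analysis.
From mathcomp Require Import zify ring lra.
Import numFieldNormedType.Exports.
(* [eval] is also a name of the topology library. *)
Import Defs.
Set Implicit Arguments. Unset Strict Implicit. Unset Printing Implicit Defensive.
Import Order.TTheory GRing.Theory Num.Theory.
Local Open Scope ring_scope.
Local Open Scope classical_set_scope.

(** * Farkas' lemma and an entropy estimate *)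

(* [P] stands for the conical hull of the [f j], described by its closure properties. *)
Lemma farkas (R : realFieldType) (I : finType) (J : eqType) (s : seq J)
    (f : J -> I -> R) (g : I -> R) (P : (I -> R) -> Prop) :
  P (fun=> 0) -> (forall c d, P c -> P d -> P (fun i => c i + d i)) ->
  (forall k c, 0 <= k -> P c -> P (fun i => k * c i)) ->
  (forall j, j \in s -> P (f j)) ->
  (forall v, (forall j, j \in s -> 0 <= \sum_i f j i * v i) ->
     0 <= \sum_i g i * v i) ->
  P g.
Proof.
move=> P0 PD PZ; elim: s f g => [|j s IH] f g Pf fg.
  (* Without generators, the test vector [- g] forces [g] to vanish. *)
  suff -> : g = fun=> 0 by [].
  have g0 : \sum_i g i * g i = 0.
    apply/eqP; rewrite eq_le sumr_ge0 ?andbT => [|i _]; last exact: sqr_ge0.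
    have := fg (fun i => - g i) (fun j => ltac:(by [])).
    by under eq_bigr do rewrite mulrN; rewrite sumrN oppr_ge0.
  apply/funext => i; apply/eqP.
  have /eqP := g0; rewrite psumr_eq0 => [|k _]; last exact: sqr_ge0.
  by move=> /allP/(_ i (mem_index_enum _)); rewrite mulf_eq0 orbb.
have [gpos|] := pselect (forall v, (forall j, j \in s -> 0 <= \sum_i f j i * v i) ->
     0 <= \sum_i g i * v i).
  by apply: (IH f) => // k ks; apply: Pf; rewrite inE ks orbT.
move=> /existsNP[v /not_implyP[fv /negP]]; rewrite -ltNge => gv.
have fjv : \sum_i f j i * v i < 0.
  rewrite ltNge; apply/negP => fjv; move: gv; rewrite ltNge fg// => k.
  by rewrite inE => /predU1P[->|/fv].
pose dot (c d : I -> R) := \sum_i c i * d i.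
have dotDZ c k d w : dot (fun i => c i + k * d i) w = dot c w + k * dot d w.
  rewrite /dot mulr_sumr -big_split; apply: eq_bigr => i _ /=; ring.
have dotDZr c k d w : dot w (fun i => c i + k * d i) = dot w c + k * dot w d.
  rewrite /dot mulr_sumr -big_split; apply: eq_bigr => i _ /=; ring.
pose e := - dot (f j) v.
have e0 : 0 < e by rewrite oppr_gt0.
have Pj : P (f j) by apply: Pf; rewrite inE eqxx.
(* [f'] and [g'] are projections along [f j] onto the hyperplane orthogonal to [v]; [u] below is the
   adjoint projection of [w], orthogonal to [f j]. Since [g] is negative on [v], it is recovered
   from [g'] by adding a nonnegative multiple of [f j]. *)
pose f' k i := f k i + dot (f k) v / e * f j i.
pose g' i := g i + dot g v / e * f j i.
have Pg' : P g'.
  apply: (IH f') => [k ks|w fw].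
    apply: PD; first by apply: Pf; rewrite inE ks orbT.
    by apply: PZ => //; apply: divr_ge0 (ltW e0); exact: fv.
  pose u i := w i + dot (f j) w / e * v i.
  have fu c : dot (fun i => c i + dot c v / e * f j i) w = dot c u.
    by rewrite dotDZ dotDZr; ring.
  rewrite -/(dot g' w) fu; apply: fg => k; rewrite inE => /predU1P[->|ks].
    rewrite -/(dot (f j) u) dotDZr; suff -> : dot (f j) v = - e.
      by rewrite mulrN divfK ?gt_eqF// subrr.
    by rewrite opprK.
  by rewrite -/(dot (f k) u) -fu; exact: fw.
have -> : g = fun i => g' i + - dot g v / e * f j i.
  by apply/funext => i; rewrite /g'; ring.
apply: PD => //; apply: PZ => //.
by rewrite divr_ge0 ?(ltW e0)// oppr_ge0 ltW.
Qed.

Lemma sum_pair (V : nmodType) (S T : finType) (h : S * T -> V) :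
  \sum_i h i = \sum_a \sum_x h (a, x).
Proof. by rewrite pair_big; apply: eq_bigr => -[]. Qed.

Lemma sum_delta (R : pzSemiRingType) (T : finType) (x : T) (h : T -> R) :
  \sum_i (i == x)%:R * h i = h x.
Proof.
rewrite (bigD1 x)//= eqxx mul1r big1 ?addr0// => i /negPf->.
by rewrite mul0r.
Qed.

Lemma sum_enum_val (V : nmodType) (T : finType) (h : T -> V) :
  \sum_(s < #|{: T}|) h (enum_val s) = \sum_t h t.
Proof. by rewrite -big_enum_val. Qed.

Lemma ln_le_subr1 (R : realType) (u : R) : 0 < u -> ln u <= u - 1.
Proof.
by move=> u0; have := expR_ge1Dx (ln u); rewrite lnK ?posrE// lerBrDl.
Qed.

(* Gibbs' inequality against the weight [e / S] on the outcomes other than [i0]. *)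
Lemma shannon_upper_bound (R : realType) n (q : 'I_n -> R) i0 (e : R) (S : nat) :
  (forall i, 0 <= q i) -> \sum_i q i = 1 -> 1 - e <= q i0 -> 0 < e <= 1 ->
  (0 < S)%N -> (#|[pred i | (i != i0) && (0 < q i)%R]| <= S)%N ->
  shannon q <= e * (1 + ln S%:R - ln e) / ln 2.
Proof.
move=> q0 q1 qi0 /andP[e0 e1] S0 cardS.
have ln2 : 0 < ln (2 : R) by rewrite ln_gt0// ltr1n.
have SR : 0 < S%:R :> R by rewrite ltr0n.
have S1 : 1 <= S%:R :> R by rewrite ler1n.
rewrite ler_pdivlMr// /shannon mulNr mulr_suml.
rewrite (eq_bigr (fun i => if 0 < q i then q i * ln (q i) else 0)) => [|i _]; last first.
  by case: ifP => _; rewrite ?mul0r// -mulrA divfK ?gt_eqF.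
pose t : R := e / S%:R.
have t0 : 0 < t by rewrite divr_gt0.
have lnt : - ln t = ln S%:R - ln e by rewrite ln_div ?posrE// opprB.
have lnt0 : ln t <= 0.
  by rewrite ln_le0// ler_pdivrMr// mul1r (le_trans e1).
rewrite -addrA -lnt (bigD1 i0)//= opprD -sumrN.
set m := 1 - q i0.
have i0P : - (if 0 < q i0 then q i0 * ln (q i0) else 0) <= m.
  case: ifPn => qpos; last first.
    rewrite oppr0 subr_ge0 -q1 (bigD1 i0)//= lerDl.
    by rewrite sumr_ge0.
  have := @ln_le_subr1 _ (q i0)^-1; rewrite invr_gt0 => /(_ qpos).
  rewrite lnV ?posrE// => h; rewrite -mulrN.
  apply: (@le_trans _ _ (q i0 * ((q i0)^-1 - 1))); first by rewrite ler_wpM2l.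
  by rewrite mulrBr mulr1 divff// gt_eqF.
have iP i : - (if 0 < q i then q i * ln (q i) else 0) <=
    q i * (- ln t - 1) + (if 0 < q i then t else 0).
  case: ifPn => qpos; last first.
    suff -> : q i = 0 by rewrite oppr0 mul0r addr0.
    by apply/eqP; rewrite eq_le q0 leNgt qpos.
  have := @ln_le_subr1 _ (t / q i); rewrite divr_gt0// => /(_ erefl).
  rewrite ln_div ?posrE// => h.
  have : q i * (ln t - ln (q i)) <= q i * (t / q i - 1) by rewrite ler_wpM2l.
  rewrite [in leRHS]mulrBr mulrCA divff ?gt_eqF// mulr1; lra.
have qm : \sum_(i | i != i0) q i = m by rewrite /m -q1 [in RHS](bigD1 i0)//= addrAC subrr add0r.
have me : m <= e by rewrite /m; lra.
(* The linear terms in [m] cancel, leaving [m * - ln t + e] with [m <= e]. *)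
apply: (@le_trans _ _ (m + (m * (- ln t - 1) + e))).
  apply: lerD => //.
  apply: le_trans (ler_sum _ (fun i _ => iP i)) _.
  rewrite big_split /= -mulr_suml qm lerD2l -big_mkcondr /=.
  rewrite sumr_const -mulr_natr -[leRHS](divfK (lt0r_neq0 SR)).
  by rewrite ler_wpM2l ?(ltW t0)// ler_nat.
have : m * - ln t <= e * - ln t by rewrite ler_wpM2r// oppr_ge0.
by rewrite mulrBr mulr1 mulrDr mulr1; lra.
Qed.

(** * Effects, maximally informative measurements and entropy bounds *)

Section BoxTheory.
Variables (R : realType) (B : finType) (kin kout : B -> nat).
Implicit Types (p : bvec R kin kout) (a : Out kout) (x : Inp kin).

Definition strategy := forall b : B, 'I_(kin b).+1 -> 'I_(kout b).+1.

Definition response (F : strategy) x : Out kout := [ffun b => F b (x b)].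

Definition det (F : strategy) : bvec R kin kout :=
  fun a x => (a == response F x)%:R.

Definition outcome a0 x0 : bvec R kin kout := fun a x => ((a == a0) && (x == x0))%:R.

Lemma eval_outcome a0 x0 p : eval (outcome a0 x0) p = p a0 x0.
Proof.
rewrite /eval (bigD1 a0)//= (bigD1 x0)//= /outcome !eqxx mul1r.
rewrite big1 ?addr0 => [|x /negPf->]; last by rewrite mul0r.
by rewrite big1 ?addr0// => a /negPf->; rewrite big1// => x _; rewrite mul0r.
Qed.

Lemma det_response F x : det F (response F x) x = 1.
Proof. by rewrite /det eqxx. Qed.

Lemma sum_det (Q : pred (Out kout)) F x :
  \sum_(a | Q a) det F a x = (Q (response F x))%:R.
Proof.
rewrite big_mkcond (bigD1 (response F x))//= /det eqxx big1 ?addr0.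
  by case: (Q _).
by move=> a /negPf->; case: (Q a).
Qed.

(** Each box answers its own input only, so deterministic strategies are no-signalling, and the
    conditions on states survive convex combinations. *)
Lemma mixture_state (T : finType) (w : T -> R) (F : T -> strategy) :
  (forall t, 0 <= w t) -> \sum_t w t = 1 ->
  is_state (fun a x => \sum_t w t * det (F t) a x).
Proof.
move=> w0 w1.
have sumE (Q : pred (Out kout)) x : \sum_(a | Q a) \sum_t w t * det (F t) a x =
    \sum_t w t * (Q (response (F t) x))%:R.
  by rewrite exchange_big; apply: eq_bigr => t _; rewrite -mulr_sumr sum_det.
split=> [a x|x|i x x' xx' a].
- by apply: sumr_ge0 => t _; rewrite mulr_ge0.
- by rewrite sumE -[RHS]w1; apply: eq_bigr => t _; rewrite mulr1.
- rewrite !sumE; apply: eq_bigr => t _; congr (_ * _%:R).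
  by congr nat_of_bool; apply: eq_forallb => j; case: eqVneq => //= ji; rewrite !ffunE xx'.
Qed.

Lemma det_state F : is_state (det F).
Proof.
have := @mixture_state unit (fun=> 1) (fun=> F) (fun=> ler01).
rewrite big_const card_unit /= addr0 => /(_ erefl).
suff -> : (fun a x => \sum_(t : unit) 1 * det F a x) = det F by [].
by apply/funext => a; apply/funext => x; rewrite big_const card_unit /= addr0 mul1r.
Qed.

Lemma state_le1 p a x : is_state p -> p a x <= 1.
Proof.
case=> p0 p1 _; rewrite -(p1 x) (bigD1 a)//= lerDl sumr_ge0// => a' _; exact: p0.
Qed.

Lemma outcome_effect a x : is_effect (outcome a x).
Proof. by move=> p sp; rewrite eval_outcome state_le1//; case: sp => ->. Qed.

(** By Farkas' lemma it suffices to test [c] on nonnegative vectors [v] satisfying the linear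
    equalities in [inv]; such a [v] is zero or a positive multiple of a state. *)
Lemma effect_decomposition (c : bvec R kin kout) : is_effect c ->
  exists l : bvec R kin kout, (forall a x, 0 <= l a x) /\
    forall p, is_state p -> eval c p = eval l p.
Proof.
move=> ec.
pose I := (Out kout * Inp kin)%type.
pose J := (I + {set Out kout} * Inp kin * Inp kin)%type.
(* Instead of listing constraints, [inv] collects all equalities between sums over one output set at
   two inputs that hold on every state. No-signalling and the independence of the total mass from
   the input are among them. *)
pose inv (G : {set Out kout}) x y :=
  forall p, is_state p -> \sum_(a in G) p a x = \sum_(a in G) p a y.
pose f (j : J) (i : I) : R := match j with
  | inl k => (i == k)%:R
  | inr (G, x, y) =>
    if `[< inv G x y >] then (i.1 \in G)%:R * ((i.2 == x)%:R - (i.2 == y)%:R) else 0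
  end.
pose P (d : I -> R) := exists l : Out kout -> Inp kin -> R, (forall a x, 0 <= l a x) /\
    forall p, is_state p -> \sum_i d i * p i.1 i.2 = \sum_a \sum_x l a x * p a x.
have dotG (G : {set Out kout}) x y (v : I -> R) :
    \sum_i (i.1 \in G)%:R * ((i.2 == x)%:R - (i.2 == y)%:R) * v i =
    \sum_(a in G) v (a, x) - \sum_(a in G) v (a, y).
  rewrite -sumrB [RHS]big_mkcond sum_pair /=; apply: eq_bigr => a _.
  case: (a \in G); last by rewrite big1// => z _; rewrite !mul0r.
  under eq_bigr do rewrite mul1r mulrBl.
  by rewrite sumrB !sum_delta.
suff [l [l0 lE]] : P (fun i => c i.1 i.2).
  by exists l; split=> // p sp; rewrite -[RHS](lE p sp) /eval pair_big.
apply: (@farkas _ _ _ (enum {: J}) f).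
- by exists (fun _ _ => 0); split=> // p _; rewrite !big1// => [a _|i _]; rewrite ?big1// => *; rewrite mul0r.
- move=> d e [l [l0 lE]] [m [m0 mE]]; exists (fun a x => l a x + m a x).
  split=> [a x|p sp]; first by rewrite addr_ge0.
  under eq_bigr do rewrite mulrDl.
  rewrite big_split/= lE// mE// -big_split; apply: eq_bigr => a _.
  by rewrite -big_split; apply: eq_bigr => x _; rewrite mulrDl.
- move=> k d k0 [l [l0 lE]]; exists (fun a x => k * l a x).
  split=> [a x|p sp]; first by rewrite mulr_ge0.
  under eq_bigr do rewrite -mulrA.
  rewrite -mulr_sumr lE// mulr_sumr; apply: eq_bigr => a _.
  by rewrite mulr_sumr; apply: eq_bigr => x _; rewrite mulrA.
- move=> [[a0 x0] _|[[G x] y] _].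
    exists (outcome a0 x0); split=> // p sp.
    by rewrite pair_big.
  exists (fun _ _ => 0); split=> // p sp.
  rewrite [RHS]big1 => [|a _]; last by rewrite big1// => *; rewrite mul0r.
  rewrite /f; case: asboolP => [G0|_]; last by rewrite big1// => *; rewrite mul0r.
  by rewrite (dotG G x y (fun i => p i.1 i.2)) G0// subrr.
move=> v fv.
have v0 a x : 0 <= v (a, x).
  by have := fv (inl (a, x)) (mem_enum _ _); rewrite sum_delta.
have vG G x y : inv G x y -> \sum_(a in G) v (a, x) = \sum_(a in G) v (a, y).
  move=> Gxy; apply/eqP; rewrite eq_le -subr_ge0 -[X in _ && X]subr_ge0 -!dotG.
  have := fv (inr (G, x, y)) (mem_enum _ _).
  have := fv (inr (G, y, x)) (mem_enum _ _).
  rewrite /=; case: asboolP => [_ ->|]; last by case=> p sp; rewrite Gxy.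
  by case: asboolP => [_ ->|].
pose x0 : Inp kin := [ffun=> ord0].
pose m := \sum_a v (a, x0).
have sm x : \sum_a v (a, x) = m.
  have setTE (h : Out kout -> R) : \sum_(a in [set: Out kout]%SET) h a = \sum_a h a.
    by apply: eq_bigl => a; rewrite inE.
  rewrite /m -!setTE; apply: vG => p [_ p1 _].
  by rewrite !setTE !p1.
have m0 : 0 <= m by rewrite sumr_ge0.
have [m00|mn0] := eqVneq m 0.
  rewrite big1// => -[a x] _; suff -> : v (a, x) = 0 by rewrite mulr0.
  apply/eqP; have /eqP := sm x; rewrite m00 psumr_eq0//.
  by move=> /allP/(_ a (mem_index_enum _)).
have sv : is_state (fun a x => v (a, x) / m).
  split=> [a x|x|i x x' xx' a]; first by rewrite divr_ge0.
    by rewrite -mulr_suml sm divff.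
  rewrite -!mulr_suml; congr (_ / _).
  pose G := [set a' : Out kout | [forall j, (j != i) ==> (a' j == a j)]]%SET.
  have GE (h : Out kout -> R) :
      \sum_(a' : Out kout | [forall j, (j != i) ==> (a' j == a j)]) h a' =
      \sum_(a' in G) h a'.
    by apply: eq_bigl => a'; rewrite inE.
  rewrite !GE; apply: vG => p [_ _ /(_ i x x' xx' a)].
  by rewrite !GE.
have /andP[+ _] := ec _ sv.
rewrite /eval pair_big /= => h.
have -> : \sum_i c i.1 i.2 * v i = (\sum_(i : I) c i.1 i.2 * (v (i.1, i.2) / m)) * m.
  by rewrite mulr_suml; apply: eq_bigr => -[a x] _ /=; rewrite mulrA divfK.
exact: mulr_ge0.
Qed.

Lemma eval_scale k (c : bvec R kin kout) p :
  eval (fun a x => k * c a x) p = k * eval c p.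
Proof.
rewrite /eval mulr_sumr; apply: eq_bigr => a _; rewrite mulr_sumr.
by apply: eq_bigr => x _; rewrite mulrA.
Qed.

(** Splitting every outcome into its terms [l r a x * p a x] is a refinement, hence trivial, so an
    outcome is proportional to any of its terms with nonzero coefficient. *)
Lemma max_informative_outcome n (mu : 'I_n -> bvec R kin kout) r :
  max_informative mu -> exists a x c, 0 <= c <= 1 /\
    forall p, is_state p -> eval (mu r) p = c * p a x.
Proof.
move=> [[muE mu1] mu_max].
have /choice[l lP] := fun r => effect_decomposition (muE r).
have l0 r' a x : 0 <= l r' a x by have [+ _] := lP r'; apply.
have lE r' p : is_state p -> eval (mu r') p = \sum_a \sum_x l r' a x * p a x.
  by have [_] := lP r'; apply.
pose T := ('I_n * (Out kout * Inp kin))%type.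
pose nu (s : 'I_#|{: T}|) a x : R :=
  let t := enum_val s in l t.1 t.2.1 t.2.2 * outcome t.2.1 t.2.2 a x.
pose f (s : 'I_#|{: T}|) := (enum_val s).1.
have nuE s p : eval (nu s) p =
    l (enum_val s).1 (enum_val s).2.1 (enum_val s).2.2 * p (enum_val s).2.1 (enum_val s).2.2.
  by rewrite eval_scale eval_outcome.
have nu0 s p : is_state p -> 0 <= eval (nu s) p.
  by move=> [p0 _ _]; rewrite nuE mulr_ge0.
have ref : refines_via mu nu f.
  move=> r' p sp; rewrite lE// pair_big [RHS]big_mkcond /=.
  pose h (t : T) := if t.1 == r' then l t.1 t.2.1 t.2.2 * p t.2.1 t.2.2 else 0.
  transitivity (\sum_(s < #|{: T}|) h (enum_val s)); last first.
    by apply: eq_bigr => s _; rewrite nuE.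
  rewrite sum_enum_val sum_pair (bigD1 r')//= [X in _ + X]big1 ?addr0.
    by apply: eq_bigr => u _; rewrite /h /= eqxx.
  by move=> i /negPf ir; apply: big1 => u _; rewrite /h /= ir.
have nu_meas : is_meas nu.
  split=> [s p sp|p sp].
    rewrite nu0//= (le_trans _ (andP (muE (f s) p sp)).2)//.
    by rewrite (ref (f s))// (bigD1 s)//= lerDl sumr_ge0// => *; exact: nu0.
  rewrite -(mu1 p sp) (partition_big f xpredT)//=.
  by apply: eq_bigr => r' _; rewrite (ref r').
have triv := mu_max _ _ _ nu_meas ref.
have [[a [x /eqP lax]]|l00] := pselect (exists a x, l r a x <> 0); last first.
  exists [ffun=> ord0], [ffun=> ord0], 0; rewrite lexx ler01; split=> // p sp.
  rewrite mul0r lE// big1// => a _; rewrite big1// => x _.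
  suff -> : l r a x = 0 by rewrite mul0r.
  by apply: contrapT => lax; apply: l00; exists a, x.
(* In the state that always outputs [a], the value [p a x] is 1; this excludes [c = 0] and shows
   that the new coefficient is a probability. *)
pose F : strategy := fun b _ => a b.
have Fx : det F a x = 1.
  by rewrite -[a in det F a x](_ : response F x = a) ?det_response//; apply/ffunP => b; rewrite ffunE.
have [c cE] := triv (enum_rank (r, (a, x))).
have {}cE p : is_state p -> l r a x * p a x = c * eval (mu r) p.
  by move=> sp; have := cE p sp; rewrite nuE /f enum_rankK.
have c0 : c != 0.
  apply/eqP => c0; have /eqP := cE _ (det_state F).
  by rewrite c0 mul0r Fx mulr1 (negPf lax).
have muD : eval (mu r) (det F) = l r a x / c.
  by apply: (mulfI c0); rewrite -cE; [rewrite Fx mulr1 mulrC divfK|exact: det_state].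
exists a, x, (l r a x / c); split; first by rewrite -muD muE//; exact: det_state.
by move=> p sp; apply: (mulfI c0); rewrite -cE// mulrA; congr (_ * _); rewrite mulrC divfK.
Qed.

(** An outcome that [q] can produce has probability at most [tau^-1] in [p], so its surprisal is at
    least log2 of [tau]; as [c * q <= p], such outcomes carry mass at least [c]. All others
    contribute nonnegatively. *)
Lemma entropy_lower_bound n (mu : 'I_n -> bvec R kin kout) p q c tau :
  is_state p -> is_state q -> 0 <= c -> 1 <= tau ->
  (forall a x, c * q a x <= p a x) ->
  (forall a x, 0 < q a x -> p a x <= tau^-1) ->
  max_informative mu -> c * (ln tau / ln 2) <= shannon (fun r => eval (mu r) p).
Proof.
move=> sp sq c0 tau1 qp qtau mu_max.
have tau0 : 0 < tau by rewrite (lt_le_trans ltr01).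
have ln2 : 0 < ln (2 : R) by rewrite ln_gt0// ltr1n.
have q1 : \sum_(r < n) eval (mu r) q = 1 by have [[_ mu1] _] := mu_max; exact: mu1.
have -> : c * (ln tau / ln 2) = \sum_(r < n) c * eval (mu r) q * (ln tau / ln 2).
  by rewrite -mulr_suml -mulr_sumr q1 mulr1.
rewrite /shannon -sumrN; apply: ler_sum => r _.
have [a [x [k [/andP[k0 k1] kE]]]] := max_informative_outcome r mu_max.
rewrite !kE//.
have p0 : 0 <= p a x by case: sp.
have q0 : 0 <= q a x by case: sq.
have p1 : p a x <= 1 := state_le1 a x sp.
have lt0 : 0 <= ln tau / ln 2 by rewrite divr_ge0 ?(ltW ln2)// ln_ge0.
have [kq|kq] := ltP 0 (k * q a x); last first.
  have -> : k * q a x = 0 by apply/eqP; rewrite eq_le kq mulr_ge0.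
  rewrite mulr0 mul0r; case: ifP => kp; last by rewrite oppr0.
  rewrite oppr_ge0 mulr_ge0_le0 ?mulr_ge0// pmulr_lle0 ?invr_gt0//.
  by rewrite ln_le0// mulr_ile1.
have qpos : 0 < q a x by rewrite lt_neqAle q0 andbT eq_sym; apply: contraTN kq => /eqP->; rewrite mulr0 ltxx.
have kqp : c * (k * q a x) <= k * p a x by rewrite mulrCA ler_wpM2l.
case: ifP => kp; last first.
  rewrite oppr0 mulr_le0_ge0//; apply: (le_trans kqp).
  by rewrite leNgt kp.
apply: (@le_trans _ _ (k * p a x * (ln tau / ln 2))); first by rewrite ler_wpM2r.
rewrite -mulrN ler_wpM2l ?(ltW kp)// -mulNr ler_wpM2r ?invr_ge0 ?(ltW ln2)//.
rewrite -lnV ?posrE// ler_ln ?posrE ?invr_gt0//.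
rewrite -[leLHS]invrK lef_pV2 ?posrE ?invr_gt0 ?invrK//.
apply: le_trans (qtau a x qpos); exact: ler_piMl.
Qed.

Hypothesis kout_gt0 : forall b, (0 < kout b)%N.

(* If (a', x') <> (a, x), some deterministic state gives a' on x' with certainty
   but never a on x; hence fine-grained outcomes span extreme rays. *)
Lemma outcome_extremal (nu : bvec R kin kout) a x : is_effect nu ->
  (forall p, is_state p -> eval nu p <= p a x) ->
  exists c, forall p, is_state p -> eval nu p = c * p a x.
Proof.
move=> /effect_decomposition[l [l0 lE]] nu_le.
suff lz a' x' : (a', x') != (a, x) -> l a' x' = 0.
  exists (l a x) => p sp; rewrite lE// /eval pair_big /= (bigD1 (a, x))//=.
  by rewrite big1 ?addr0// => -[a' x'] /lz -> /=; rewrite mul0r.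
move=> ax'.
(* [kout b] is one less than the number of outputs, so [kout_gt0] makes [ord0] and [ord_max]
   distinct. *)
pose other (b : B) (i : 'I_(kout b).+1) : 'I_(kout b).+1 := if i == ord0 then ord_max else ord0.
have otherN b (i : 'I_(kout b).+1) : other b i != i.
  rewrite /other; case: ifPn => [/eqP->|]; last by rewrite eq_sym.
  by rewrite -val_eqE /= -lt0n.
pose F : strategy := fun b s => if s == x' b then a' b else other b (a b).
have Fx' : response F x' = a' by apply/ffunP => b; rewrite ffunE /F eqxx.
have Fx : response F x != a.
  apply: contraNneq ax' => Fxa.
  have xx' : x = x'.
    apply/ffunP => b; apply/eqP; have : response F x b = a b by rewrite Fxa.
    rewrite ffunE /F; case: eqVneq => // _ /eqP.
    by rewrite (negPf (otherN _ _)).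
  by rewrite -Fxa xx' Fx'.
apply/eqP; rewrite eq_le l0 andbT.
have := nu_le _ (det_state F); rewrite lE; last exact: det_state.
rewrite {2}/det eq_sym (negPf Fx) => /(le_trans _); apply.
rewrite /eval pair_big /= (bigD1 (a', x'))//= [det F a' x'](_ : _ = 1); last by rewrite -[in LHS]Fx' det_response.
rewrite mulr1 lerDl.
by rewrite sumr_ge0// => i _; rewrite mulr_ge0 /det.
Qed.

Definition adaptive (x : Out kout -> Inp kin) (r : 'I_#|{: Out kout}|) : bvec R kin kout :=
  outcome (enum_val r) (x (enum_val r)).

(** An effect in a refinement is dominated by some [p a (x a)], and [outcome_extremal] makes it a
    multiple of that. *)
Lemma adaptive_max_informative (x : Out kout -> Inp kin) :
  (forall p, is_state p -> \sum_a p a (x a) = 1) -> max_informative (adaptive x).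
Proof.
move=> x1; split.
  split=> [r|p sp]; first exact: outcome_effect.
  rewrite -(x1 p sp) -(sum_enum_val (fun a => p a (x a))).
  by apply: eq_bigr => r _; rewrite eval_outcome.
move=> m nu f [nuE _] ref s.
have nu_le p : is_state p -> eval (nu s) p <= eval (adaptive x (f s)) p.
  move=> sp; rewrite ref// (bigD1 s)//= lerDl sumr_ge0// => s' _.
  by case/andP: (nuE s' p sp).
have [c cE] : exists c, forall p, is_state p ->
    eval (nu s) p = c * p (enum_val (f s)) (x (enum_val (f s))).
  by apply: outcome_extremal => // p sp; rewrite -eval_outcome nu_le.
by exists c => p sp; rewrite cE// eval_outcome.
Qed.

Lemma entropy_ge0 n (mu : 'I_n -> bvec R kin kout) p : is_state p ->
  max_informative mu -> 0 <= shannon (fun r => eval (mu r) p).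
Proof.
move=> sp /(@entropy_lower_bound _ mu p p 0 1 sp sp (lexx _) (lexx _)).
rewrite mul0r; apply=> a x; first by rewrite mul0r; case: sp.
by move=> _; rewrite invr1 state_le1.
Qed.

Lemma meas_entropy_le p (x : Out kout -> Inp kin) a0 (e : R) (S : nat) : is_state p ->
  (forall p', is_state p' -> \sum_a p' a (x a) = 1) ->
  1 - e <= p a0 (x a0) -> 0 < e <= 1 -> (0 < S)%N ->
  (#|[pred a | (a != a0) && (0 < p a (x a))%R]| <= S)%N ->
  meas_entropy p <= e * (1 + ln S%:R - ln e) / ln 2.
Proof.
move=> sp x1 pa0 e01 S0 cardS.
apply: (@le_trans _ _ (shannon (fun r => eval (adaptive x r) p))).
  apply: ge_inf; first by exists 0 => _ [n [mu [mu_max ->]]]; exact: entropy_ge0.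
  by exists _, (adaptive x); split=> //; exact: adaptive_max_informative.
apply: (@shannon_upper_bound _ _ _ (enum_rank a0)) => //.
- by move=> r; rewrite eval_outcome; case: sp.
- by have [[_ mu1] _] := adaptive_max_informative x1; exact: mu1.
- by rewrite eval_outcome enum_rankK.
apply: leq_trans cardS; rewrite -(card_imset _ enum_val_inj); apply: subset_leq_card.
apply/fintype.subsetP => a /imsetP[r]; rewrite !inE eval_outcome => /andP[ra pr ->].
by rewrite pr andbT; apply: contraNneq ra => <-; rewrite enum_valK.
Qed.

Lemma meas_entropy_ge p q c tau : is_state p -> is_state q -> 0 <= c -> 1 <= tau ->
  (forall a x, c * q a x <= p a x) ->
  (forall a x, 0 < q a x -> p a x <= tau^-1) ->
  c * (ln tau / ln 2) <= meas_entropy p.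
Proof.
move=> sp sq c0 tau1 qp qtau; apply: lb_le_inf.
  (* Fixing all inputs to 0 shows that the infimum is over a nonempty set. *)
  pose x : Out kout -> Inp kin := fun=> [ffun=> ord0].
  exists (shannon (fun r => eval (adaptive x r) p)), _, (adaptive x); split=> //.
  by apply: adaptive_max_informative => p' [_ p1 _]; exact: p1.
move=> _ [n [mu [mu_max ->]]].
exact: (@entropy_lower_bound _ _ _ q).
Qed.

(** * No-signalling for general events and adaptive inputs *)

(** An event independent of the output of box [i] is a disjoint union of the fibres summed in the
    definition of a state; [erase] selects a representative of each fibre. *)
Lemma no_signalling_closed p i x x' (G : pred (Out kout)) : is_state p ->
  (forall j, j != i -> x j = x' j) ->
  (forall a a', (forall j, j != i -> a j = a' j) -> G a = G a') ->
  \sum_(a | G a) p a x = \sum_(a | G a) p a x'.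
Proof.
move=> [_ _ ns] xx' Gi.
pose erase (a : Out kout) : Out kout := [ffun j => if j == i then ord0 else a j].
have Gerase a : G (erase a) = G a.
  by apply: Gi => j ji; rewrite ffunE (negPf ji).
rewrite (partition_big erase G) => [|a]; last by rewrite Gerase.
rewrite [RHS](partition_big erase G) => [|a]; last by rewrite Gerase.
apply: eq_bigr => c Gc.
have [/eqP cc|cc] := boolP (erase c == c); last first.
  rewrite !big_pred0// => a; apply/negP => /andP[_ /eqP ac];
    by case/eqP: cc; rewrite -ac; apply/ffunP => j; rewrite !ffunE; case: eqP.
have E y : \sum_(a | G a && (erase a == c)) p a y =
    \sum_(a' : Out kout | [forall j, (j != i) ==> (a' j == c j)]) p a' y.
  apply: eq_bigl => a; apply/andP/forallP => [[_ /eqP <-] j|ac].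
    by apply/implyP => /negPf ji; rewrite ffunE ji.
  have ac' : forall j, j != i -> a j = c j by move=> j ji; have /implyP/(_ ji)/eqP := ac j.
  rewrite (Gi _ _ ac'); split=> //.
  by rewrite -[eqbRHS]cc; apply/eqP; apply/ffunP => j; rewrite !ffunE; case: eqVneq => // /ac'.
by rewrite !E; apply: ns.
Qed.

Lemma no_signalling_closed_seq p (s : seq B) x x' (G : pred (Out kout)) : is_state p ->
  (forall j, j \notin s -> x j = x' j) ->
  (forall a a', (forall j, j \notin s -> a j = a' j) -> G a = G a') ->
  \sum_(a | G a) p a x = \sum_(a | G a) p a x'.
Proof.
move=> sp; elim: s x => [|i s IH] x xx' Gs.
  by have -> : x = x' by apply/ffunP => j; rewrite xx'.
pose x2 : Inp kin := [ffun j => if j == i then x' j else x j].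
rewrite (@no_signalling_closed p i x x2)//.
- apply: IH => [j js|a a' aa'].
    by rewrite ffunE; case: eqVneq => // ji; rewrite xx'// inE negb_or ji.
  by apply: Gs => j; rewrite inE negb_or => /andP[_]; exact: aa'.
- by move=> j /negPf ji; rewrite ffunE ji.
by move=> a a' aa'; apply: Gs => j; rewrite inE negb_or => /andP[ji _]; exact: aa'.
Qed.

(* The boxes outside [s] are measured first with fixed inputs; the inputs of the
   boxes in [s] may then depend on the outputs of the former. *)
Lemma adaptive_normalized p (s : seq B) (x : Out kout -> Inp kin) x0 : is_state p ->
  (forall a j, j \notin s -> x a j = x0 j) ->
  (forall a a', (forall j, j \notin s -> a j = a' j) -> x a = x a') ->
  \sum_a p a (x a) = 1.
Proof.
move=> sp xx0 xs.
have [_ p1 _] := sp; rewrite -(p1 x0).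
(* Outputs are grouped by the chosen input [y]; the event [x a = y] ignores the boxes in [s], so its
   probability is the same at [y] and at [x0]. *)
rewrite (partition_big x xpredT)// [RHS](partition_big x xpredT)//=.
apply: eq_bigr => y _; rewrite (eq_bigr (fun a => p a y)) => [|a /eqP->//].
have [/existsP[b /eqP xb]|no] := boolP [exists b, x b == y]; last first.
  by rewrite !big_pred0// => a; apply: contraNF no => ay; apply/existsP; exists a.
apply: (@no_signalling_closed_seq _ s) => // [j js|a a' /xs->//].
by rewrite -xb xx0.
Qed.

End BoxTheory.

(** * Mixtures of the idle strategy with uniformly chosen strategies *)

Section Dilution.
Variables (R : realType) (B : finType) (kin kout : B -> nat) (T : finType).
Variables (F : T -> strategy kin kout) (e : R).

Definition idle : strategy kin kout := fun _ _ => ord0.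

Definition diluted : bvec R kin kout := fun a x =>
  (1 - e) * det R idle a x + e / #|T|%:R * \sum_t det R (F t) a x.

Hypotheses (e01 : 0 <= e <= 1) (T0 : (0 < #|T|)%N).

Lemma diluted_state : is_state diluted.
Proof.
have [e0 e1] := andP e01.
pose w (o : option T) : R := if o is Some _ then e / #|T|%:R else 1 - e.
pose F' (o : option T) := if o is Some t then F t else idle.
have sum_option (h : option T -> R) : \sum_o h o = h None + \sum_t h (Some t).
  rewrite (bigD1 None)//=; congr (_ + _).
  by rewrite (reindex_omap Some id)/= => [|[]//]; apply: eq_bigl => t; rewrite eqxx.
have := @mixture_state R B kin kout _ w F'; rewrite sum_option /= sumr_const.
rewrite -(mulr_natr (e / #|T|%:R)) divfK ?pnatr_eq0 -?lt0n// subrK.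
suff -> : diluted = fun a x => \sum_o w o * det R (F' o) a x.
  by apply=> // -[t|] /=; rewrite ?subr_ge0 ?divr_ge0.
by apply/funext => a; apply/funext => x; rewrite sum_option /= -mulr_sumr.
Qed.

(** A non-idle [a] has probability [e] times the fraction of [t] compatible with it; [rho] records
    what [a] leaves open about [t], which bounds their number. *)
Lemma diluted_le (A : finType) (rho : T -> A) a x : a != response idle x ->
  {in [pred t | a == response (F t) x] &, injective rho} ->
  diluted a x <= #|A|%:R / #|T|%:R.
Proof.
move=> /negPf a0 rho_inj; have [e0 e1] := andP e01.
rewrite /diluted {1}/det a0 mulr0 add0r mulrAC ler_wpM2r ?invr_ge0//.
apply: (@le_trans _ _ (1 * #|[pred t | a == response (F t) x]|%:R)).
  apply: ler_pM => //; first exact: sumr_ge0.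
  rewrite /det -natr_sum ler_nat -sum1_card [leqRHS]big_mkcond /=.
  by apply: eq_leq; apply: eq_bigr => t _; rewrite inE; case: eqP.
by rewrite mul1r ler_nat -(card_in_imset rho_inj) max_card.
Qed.

Lemma diluted_gt0 a x : (a != response idle x) || (e == 1) -> 0 < diluted a x ->
  exists t, a = response (F t) x.
Proof.
move=> a0; rewrite /diluted (_ : (1 - e) * _ = 0) ?add0r; last first.
  by case/orP: a0 => [/negPf a0|/eqP->]; rewrite ?subrr ?mul0r// /det a0 mulr0.
move=> p0; apply: contrapT => no; move: p0; rewrite big1 ?mulr0 ?ltxx// => t _.
by rewrite /det; case: eqP => // at_; case: no; exists t.
Qed.

(** Idling outputs zeros at every input, so this single outcome has probability at least [1 - e];
    the others that occur lie in the range of [G]. *)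
Lemma diluted_entropy_le (x : Out kout -> Inp kin) (A : finType) (G : A -> Out kout) :
  0 < e -> (0 < #|A|)%N -> (forall b, 0 < kout b)%N ->
  (forall p : bvec R kin kout, is_state p -> \sum_a p a (x a) = 1) ->
  (forall a t, a = response (F t) (x a) -> exists i, a = G i) ->
  meas_entropy diluted <= e * (1 + ln #|A|%:R - ln e) / ln 2.
Proof.
move=> epos A0 kout0 x1 FG; have [e0 e1] := andP e01.
pose a0 : Out kout := [ffun=> ord0].
have a0E y : response idle y = a0 by apply/ffunP => b; rewrite !ffunE.
apply: (@meas_entropy_le _ _ _ _ kout0 _ x a0) => //.
- exact: diluted_state.
- rewrite /diluted -{1}(a0E (x a0)) det_response mulr1 lerDl.
  by rewrite mulr_ge0 ?divr_ge0 ?sumr_ge0.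
- by rewrite epos.
rewrite -(size_codom G); apply: leq_trans (card_size _).
apply/subset_leq_card/fintype.subsetP => a; rewrite inE -(a0E (x a)) => /andP[aa0 pa].
have aa0' : (a != response idle (x a)) || (e == 1) by rewrite aa0.
by have [t /FG[i ->]] := diluted_gt0 aa0' pa; exact: codom_f.
Qed.

End Dilution.

(** Averaging over an index component that the strategy ignores changes nothing. This serves to
    discard the other party's data in marginals. *)
Lemma diluted_reindex (R : realType) (B : finType) (kin kout : B -> nat) (e : R)
    (T T' A : finType) (F : T -> strategy kin kout) (F' : T' -> strategy kin kout)
    (phi : T' * A -> T) :
  (0 < #|A|)%N -> bijective phi -> (forall i, F (phi i) = F' i.1) ->
  diluted F e = diluted F' e.
Proof.
move=> A0 phi_bij FF'; apply/funext => a; apply/funext => x; congr (_ + _).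
rewrite (reindex phi) /=; last exact: onW_bij.
have <- : #|{: T' * A}| = #|T| by exact: bij_eq_card phi_bij.
rewrite card_prod natrM sum_pair /= [RHS]mulr_sumr mulr_sumr; apply: eq_bigr => t _.
under eq_bigr do rewrite FF' /=.
rewrite sumr_const -(mulr_natl (det R (F' t) a x)) !mulrA; congr (_ * _).
rewrite invfM mulrA mulfVK// pnatr_eq0 -lt0n//.
Qed.

(** * One party: a key box and a box controlled by the other key *)

Section Encode.
Variable V : finType.

(** The shift reserves output [ord0] for idling. *)
Definition encode (v : V) : 'I_#|V|.+1 := lift ord0 (enum_rank v).

Lemma encode_inj : injective encode.
Proof. by move=> u v /lift_inj/enum_rank_inj. Qed.

Lemma encode_neq0 v : encode v != ord0.
Proof. by rewrite eq_sym neq_lift. Qed.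

End Encode.

Section Party.
Variables (R : realType) (k : nat) (G D : finType).
Local Notation key := 'I_k.+1.
Local Notation value := (key + G * option D)%type.

Definition party_in : 'I_2 -> nat := fun=> k.
Definition party_out : 'I_2 -> nat := fun=> #|{: value}|.

(* Box 0 outputs the key [i]; box 1 outputs [g], together with [h] unless its
   input is [j], the key output by the other party. *)
Definition party (i j : key) (g : G) (h : D) : strategy party_in party_out :=
  fun b s => encode (if b == ord0 then inl i else inr (g, if s == j then None else Some h)).

(** The responses when box 1 never receives the key [j]: [h] is always shown. These give the
    comparison state of the lower bound. *)
Definition locked_party (i : key) (g : G) (h : D) : strategy party_in party_out :=
  fun b _ => encode (if b == ord0 then inl i else inr (g, Some h)).

Local Notation secret := ((key * key) * (G * D))%type.

Definition party_secret (t : secret) := party t.1.1 t.1.2 t.2.1 t.2.2.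
Definition locked_secret (t : secret) := locked_party t.1.1 t.2.1 t.2.2.

Lemma party_out_gt0 b : (0 < party_out b)%N.
Proof. by apply/card_gt0P; exists (inl ord0). Qed.

Variable e : R.
Hypotheses (e01 : 0 < e <= 1) (G0 : (0 < #|G|)%N) (D0 : (0 < #|D|)%N).

Let e01W : 0 <= e <= 1.
Proof. by have [/ltW-> ->] := andP e01. Qed.

Lemma card_secret : #|{: secret}| = (k.+1 ^ 2 * (#|G| * #|D|))%N.
Proof. by rewrite !card_prod !card_ord. Qed.

Let secret_gt0 : (0 < #|{: secret}|)%N.
Proof. by rewrite card_secret !muln_gt0 G0 D0. Qed.

Lemma party_entropy_le : meas_entropy (diluted party_secret e) <=
  e * (1 + ln (k.+1 ^ 2 * (#|G| * #|D|))%:R - ln e) / ln 2.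
Proof.
rewrite -card_secret.
pose x0 : Inp party_in := [ffun=> ord0].
apply: (@diluted_entropy_le _ _ _ _ _ _ _ _ _ (fun=> x0) _ (fun t => response (party_secret t) x0)) => //.
- by case/andP: e01.
- exact: party_out_gt0.
- by move=> p [_ + _]; apply.
- by move=> a t ->; exists t.
Qed.

(** At a given input both strategies agree unless [j] is the input of box 1, hence for [k] of the
    [k.+1] keys. *)
Lemma sum_locked_le (a : Out party_out) (x : Inp party_in) :
  k%:R / k.+1%:R * \sum_t det R (locked_secret t) a x <= \sum_t det R (party_secret t) a x.
Proof.
pose W := \sum_i \sum_u det R (locked_party i u.1 u.2) a x.
have sumE (h : key -> key -> G * D -> R) :
    \sum_t h t.1.1 t.1.2 t.2 = \sum_j \sum_i \sum_u h i j u.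
  by rewrite [LHS]sum_pair [LHS]sum_pair /= exchange_big.
rewrite (sumE (fun i j u => det R (locked_party i u.1 u.2) a x)).
rewrite [leRHS](sumE (fun i j u => det R (party i j u.1 u.2) a x)).
rewrite -/W sumr_const card_ord -(mulr_natl W) mulrA divfK ?pnatr_eq0//.
rewrite (bigD1 (x ord_max))//= -[leLHS]add0r lerD//.
  by apply: sumr_ge0 => i _; apply: sumr_ge0.
rewrite (eq_bigr (fun=> W)) => [|j jx]; last first.
  apply: eq_bigr => i _; apply: eq_bigr => u _; rewrite /det; congr (_ == _)%:R.
  apply/ffunP => b; rewrite !ffunE /locked_party /party; case: ifPn => // b0.
  suff -> : b = ord_max by rewrite eq_sym (negPf jx).
  by apply/val_inj; case: b b0 => -[|[|]].
by rewrite sumr_const (_ : #|_| = k) ?mulr_natl// cardC1 card_ord.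
Qed.

(** A locked output shows [g] and [h] and leaves at most the pair of keys open, whence [tau] is
    [#|G| * #|D|]; the factor [k / k.+1] is the probability that an input misses [j]. *)
Lemma party_entropy_ge :
  e * (k%:R / k.+1%:R) * (ln (#|G| * #|D|)%:R / ln 2) <= meas_entropy (diluted party_secret e).
Proof.
have [/ltW e0 e1] := andP e01.
apply: (@meas_entropy_ge _ _ _ _ party_out_gt0 _ (diluted locked_secret 1)).
- exact: diluted_state.
- by apply: diluted_state; rewrite ?ler01 ?lexx.
- by rewrite mulr_ge0 ?divr_ge0.
- by rewrite ler1n muln_gt0 G0.
- move=> a x; rewrite /diluted subrr mul0r add0r.
  apply: (@le_trans _ _ (e / #|{: secret}|%:R *
      (k%:R / k.+1%:R * \sum_t det R (locked_secret t) a x))).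
    by rewrite le_eqVlt; apply/orP; left; apply/eqP; ring.
  apply: ler_wpDl; first by rewrite mulr_ge0 ?subr_ge0.
  by rewrite ler_wpM2l ?divr_ge0// sum_locked_le.
move=> a x /diluted_gt0; rewrite eqxx orbT => /(_ isT)[[ij [g h]] at0].
have a_key : a ord0 = encode (inl ij.1) by rewrite at0 ffunE.
have a_box : a ord_max = encode (inr (g, Some h)) by rewrite at0 ffunE.
have -> : (#|G| * #|D|)%:R^-1 = #|{: key * key}|%:R / #|{: secret}|%:R :> R.
  rewrite -[(#|G| * #|D|)%N]card_prod [#|{: secret}|]card_prod [in RHS]natrM.
  by rewrite invfM mulrA divff ?mul1r// card_prod card_ord pnatr_eq0.
apply: (diluted_le _ (rho := fst)) => //.
  apply/eqP => /ffunP/(_ ord0); rewrite a_key !ffunE => /eqP.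
  by rewrite (negPf (encode_neq0 _)).
have boxE t : a = response (party_secret t) x -> t.2 = (g, h).
  move=> at_; have : a ord_max = party_secret t (x ord_max) by rewrite {1}at_ ffunE.
  rewrite a_box => /encode_inj[->]; case: ifP => // _ [->].
  by case: (t.2).
move=> [ij1 u1] [ij2 u2]; rewrite !inE => /eqP/boxE/= -> /eqP/boxE/= ->.
by move=> ->.
Qed.

End Party.

(** * The joint system of both parties *)

Section Joint.
Variables (R : realType) (k : nat) (GX DX GY DY : finType).
Local Notation key := 'I_k.+1.
Local Notation inJ := (sumk (party_in k) (party_in k)).
Local Notation outJ := (sumk (party_out k GX DX) (party_out k GY DY)).
Local Notation secret := ((key * key) * ((GX * DX) * (GY * DY)))%type.

(** The second party receives the keys swapped: the key output by one party is the input that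
    suppresses [h] at the other. *)
Definition joint (t : secret) : strategy inJ outJ := fun b =>
  match b return 'I_(inJ b).+1 -> 'I_(outJ b).+1 with
  | inl c => @party k GX DX t.1.1 t.1.2 t.2.1.1 t.2.1.2 c
  | inr c => @party k GY DY t.1.2 t.1.1 t.2.2.1 t.2.2.2 c
  end.

Variable e : R.

Lemma margX_det (F : strategy inJ outJ) (a : Out (party_out k GX DX)) (x : Inp (party_in k)) :
  \sum_(a' : Out outJ | [forall b, a' (inl b) == a b :> nat]) det R F a' (inpL (party_in k) x) =
  @det R _ (party_in k) (party_out k GX DX) (fun b => F (inl b)) a x.
Proof.
rewrite sum_det; congr (_ %:R); congr nat_of_bool.
apply/forallP/eqP => [aF|-> b]; last by rewrite !ffunE.
by apply/ffunP => b; rewrite ffunE; apply/val_inj; rewrite /= -(eqP (aF b)) !ffunE.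
Qed.

Lemma margY_det (F : strategy inJ outJ) (a : Out (party_out k GY DY)) (x : Inp (party_in k)) :
  \sum_(a' : Out outJ | [forall b, a' (inr b) == a b :> nat]) det R F a' (inpR (party_in k) x) =
  @det R _ (party_in k) (party_out k GY DY) (fun b => F (inr b)) a x.
Proof.
rewrite sum_det; congr (_ %:R); congr nat_of_bool.
apply/forallP/eqP => [aF|-> b]; last by rewrite !ffunE.
by apply/ffunP => b; rewrite ffunE; apply/val_inj; rewrite /= -(eqP (aF b)) !ffunE.
Qed.

(** The marginal of a deterministic strategy is its restriction, and idling restricts to idling; the
    pair in [GY * DY] is then averaged out. *)
Lemma margX_diluted : (0 < #|{: GY * DY}|)%N ->
  margX (diluted joint e) = diluted (@party_secret k GX DX) e.
Proof.
move=> Y0.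
pose phi (i : ((key * key) * (GX * DX)) * (GY * DY)) : secret := (i.1.1, (i.1.2, i.2)).
pose F (t : secret) : strategy (party_in k) (party_out k GX DX) :=
  party t.1.1 t.1.2 t.2.1.1 t.2.1.2.
transitivity (diluted F e).
  apply/funext => a; apply/funext => x; rewrite /margX /diluted.
  by rewrite big_split -!mulr_sumr exchange_big margX_det;
    congr (_ + _ * _); apply: eq_bigr => t _; rewrite margX_det.
apply: (@diluted_reindex _ _ _ _ _ _ _ _ _ _ phi) => //.
by exists (fun t => ((t.1, t.2.1), t.2.2)) => [[[? ?] ?]|[? [? ?]]].
Qed.

Lemma margY_diluted : (0 < #|{: GX * DX}|)%N ->
  margY (diluted joint e) = diluted (@party_secret k GY DY) e.
Proof.
move=> X0.
(* The keys are swapped because [party_secret] lists a party's own key first. *)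
pose phi (i : ((key * key) * (GY * DY)) * (GX * DX)) : secret :=
  ((i.1.1.2, i.1.1.1), (i.2, i.1.2)).
pose F (t : secret) : strategy (party_in k) (party_out k GY DY) :=
  party t.1.2 t.1.1 t.2.2.1 t.2.2.2.
transitivity (diluted F e).
  apply/funext => a; apply/funext => x; rewrite /margY /diluted.
  by rewrite big_split -!mulr_sumr exchange_big margY_det;
    congr (_ + _ * _); apply: eq_bigr => t _; rewrite margY_det.
apply: (@diluted_reindex _ _ _ _ _ _ _ _ _ _ phi) => //.
exists (fun t => (((t.1.2, t.1.1), t.2.2), t.2.1)) => [[[[? ?] ?] ?]|[[? ?] [? ?]]] //.
Qed.

Lemma joint_out_gt0 b : (0 < outJ b)%N.
Proof. by case: b => b; exact: party_out_gt0. Qed.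

(* Both keys are read first and then used as inputs of the other party's box. *)
Definition unlocking (i j : key) : Inp inJ := [ffun b =>
  match b return 'I_(inJ b).+1 with
  | inl c => if c == ord0 then ord0 else j
  | inr c => if c == ord0 then ord0 else i
  end].

Definition unlocked (t : (key * key) * (GX * GY)) : Out outJ := [ffun b =>
  match b return 'I_(outJ b).+1 with
  | inl c => encode (if c == ord0 then inl t.1.1 else inr (t.2.1, None) : key + GX * option DX)
  | inr c => encode (if c == ord0 then inl t.1.2 else inr (t.2.2, None) : key + GY * option DY)
  end].

(** The default key 0 covers outputs that encode no key, such as idling. *)
Definition read_keys (a : Out outJ) : Inp inJ :=
  unlocking (odflt ord0 [pick i | a (inl ord0) == encode (inl i)])
            (odflt ord0 [pick j | a (inr ord0) == encode (inl j)]).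

Lemma read_keys_normalized (p : bvec R inJ outJ) : is_state p ->
  \sum_a p a (read_keys a) = 1.
Proof.
move=> sp; pose is_key (b : 'I_2 + 'I_2) := match b with inl c | inr c => c == ord0 end.
pose s := enum [pred b | ~~ is_key b].
have sE j : (j \notin s) = is_key j by rewrite mem_enum inE negbK.
apply: (@adaptive_normalized _ _ _ _ _ s _ [ffun=> ord0]) => //.
  by move=> a [] c; rewrite sE => /= c0; rewrite !ffunE c0.
move=> a a' aa'; rewrite /read_keys; congr unlocking; congr odflt; apply: eq_pick => i.
  by rewrite aa'// sE.
by rewrite aa'// sE.
Qed.

(** The hypothesis is a fixed-point equation, since inputs depend on outputs. Key boxes ignore their
    inputs, so the keys read are the true ones, and given these neither party shows its [h]. *)
Lemma read_keys_response a t : a = response (joint t) (read_keys a) ->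
  a = unlocked (t.1, (t.2.1.1, t.2.2.1)).
Proof.
move=> aE.
have X_key : a (inl ord0) = encode (inl t.1.1 : key + GX * option DX).
  by rewrite aE ffunE.
have Y_key : a (inr ord0) = encode (inl t.1.2 : key + GY * option DY).
  by rewrite aE ffunE.
have readE : read_keys a = unlocking t.1.1 t.1.2.
  rewrite /read_keys; congr unlocking.
    by case: pickP => [u|/(_ t.1.1)]; rewrite X_key ?eqxx// => /eqP/encode_inj[->].
  by case: pickP => [u|/(_ t.1.2)]; rewrite Y_key ?eqxx// => /eqP/encode_inj[->].
rewrite aE readE; apply/ffunP => -[] c; rewrite !ffunE /= /party.
  by case: ifP => // c0; rewrite c0 eqxx.
by case: ifP => // c0; rewrite c0 eqxx.
Qed.

Hypotheses (e01 : 0 < e <= 1) (GX0 : (0 < #|GX|)%N) (DX0 : (0 < #|DX|)%N).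
Hypotheses (GY0 : (0 < #|GY|)%N) (DY0 : (0 < #|DY|)%N).

Let e01W : 0 <= e <= 1.
Proof. by have [/ltW-> ->] := andP e01. Qed.

Let secret_gt0 : (0 < #|{: secret}|)%N.
Proof. by rewrite !card_prod !card_ord !muln_gt0 GX0 DX0 GY0 DY0. Qed.

Lemma joint_state : is_state (diluted (R := R) joint e).
Proof. exact: diluted_state. Qed.

Lemma joint_entropy_le : meas_entropy (diluted joint e) <=
  e * (1 + ln (k.+1 ^ 2 * (#|GX| * #|GY|))%:R - ln e) / ln 2.
Proof.
have -> : (k.+1 ^ 2 * (#|GX| * #|GY|))%N = #|{: (key * key) * (GX * GY)}|.
  by rewrite !card_prod !card_ord.
apply: (@diluted_entropy_le _ _ _ _ _ _ _ _ _ read_keys _ unlocked) => //.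
- by case/andP: e01.
- by rewrite !card_prod !card_ord !muln_gt0 GX0 GY0.
- exact: joint_out_gt0.
- exact: read_keys_normalized.
- by move=> a t /read_keys_response ->; eexists.
Qed.

(** Both [g] are shown whatever the inputs, so the undiluted state itself serves for comparison and
    no factor is lost to guessed keys. *)
Lemma joint_entropy_ge :
  e * (ln (#|GX| * #|GY|)%:R / ln 2) <= meas_entropy (diluted joint e).
Proof.
have [/ltW e0 e1] := andP e01.
apply: (@meas_entropy_ge _ _ _ _ joint_out_gt0 _ (diluted joint 1)) => //.
- exact: joint_state.
- by apply: diluted_state; rewrite ?ler01 ?lexx.
- by rewrite ler1n muln_gt0 GX0.
- move=> a x; rewrite /diluted subrr mul0r add0r mul1r mulrA.
  by rewrite ler_wpDl// mulr_ge0 ?subr_ge0.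
move=> a x /diluted_gt0; rewrite eqxx orbT => /(_ isT)[t0 at0].
(* [A] is what may stay open once both [g] are known. *)
pose A := ((key * key) * (DX * DY))%type.
have -> : (#|GX| * #|GY|)%:R^-1 = #|{: A}|%:R / #|{: secret}|%:R :> R.
  have -> : #|{: secret}| = (#|{: A}| * (#|GX| * #|GY|))%N.
    rewrite !card_prod; lia.
  rewrite [in RHS]natrM invfM mulrA divff ?mul1r// pnatr_eq0 -lt0n.
  by rewrite !card_prod !card_ord !muln_gt0 DX0 DY0.
apply: (diluted_le _ (rho := fun t => (t.1, (t.2.1.2, t.2.2.2)))) => //.
  by apply/eqP => /ffunP/(_ (inl ord0)) /eqP; rewrite at0 !ffunE (negPf (encode_neq0 _)).
have X_box t : a = response (joint t) x -> exists o,
    a (inl ord_max) = encode (inr (t.2.1.1, o) : key + GX * option DX).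
  by move=> ->; rewrite ffunE; eexists.
have Y_box t : a = response (joint t) x -> exists o,
    a (inr ord_max) = encode (inr (t.2.2.1, o) : key + GY * option DY).
  by move=> ->; rewrite ffunE; eexists.
move=> t1 t2; rewrite !inE => /eqP at1 /eqP at2.
have [w1 X1] := X_box _ at1; have [w2] := X_box _ at2.
rewrite X1 => /encode_inj[gx _].
have [w3 Y1] := Y_box _ at1; have [w4] := Y_box _ at2.
rewrite Y1 => /encode_inj[gy _].
case: t1 t2 gx gy {at1 at2 X1 Y1} => [ij1 [[g1 h1] [g1' h1']]] [ij2 [[g2 h2] [g2' h2']]] /=.
by move=> -> -> [-> -> ->].
Qed.

End Joint.

(** * Error estimate and choice of parameters *)

(** At weight [e], the [s] random bits contribute about [x]; the slack 2 allows [s] to be a sum of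
    two truncations. *)
Lemma entropy_error (R : realType) (k s : nat) (x H : R) :
  let M : R := k.+1%:R in let e := (M ^+ 2)^-1 in
  0 <= x -> x * M ^+ 2 - 2 <= s%:R <= x * M ^+ 2 ->
  e * (k%:R / M) * (ln (2 ^ s)%:R / ln 2) <= H ->
  H <= e * (1 + ln (k.+1 ^ 2 * 2 ^ s)%:R - ln e) / ln 2 ->
  `|x - H| <= (x + 2 + 5 / ln 2) / M.
Proof.
move=> M e x0 /andP[s_ge s_le] H_ge H_le.
have M1 : 1 <= M by rewrite ler1n.
have M0 : 0 < M by rewrite ltr0n.
have ln2 : 0 < ln (2 : R) by rewrite ln_gt0// ltr1n.
have lnM_le : ln M <= M by rewrite ltW// ln_sublinear.
have lnM0 : 0 <= ln M by rewrite ln_ge0.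
pose v := M^-1.
have v0 : 0 < v by rewrite invr_gt0.
have vM : v * M = 1 by rewrite mulVf// gt_eqF.
have v1 : v <= 1 by rewrite invf_le1.
have eE : e = v ^+ 2 by rewrite /e exprVn.
have lne : ln e = - (2 * ln M).
  by rewrite /e lnV ?posrE ?exprn_gt0// lnXn// mulr_natl.
have kM : k%:R / M = 1 - v.
  apply: (mulIf (lt0r_neq0 M0)); rewrite mulrBl vM mul1r divfK ?gt_eqF//.
  by rewrite /M -natr1 addrK.
have ln2s : ln (2 ^ s)%:R = s%:R * ln 2 :> R by rewrite natrX lnXn// mulr_natl.
have es_le : e * s%:R <= x.
  have := ler_wpM2l (sqr_ge0 v) s_le.
  by rewrite mulrCA -exprMn vM expr1n mulr1 eE.
have es_ge : x - 2 * v <= e * s%:R.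
  have := ler_wpM2l (sqr_ge0 v) s_ge.
  rewrite mulrBr mulrCA -exprMn vM expr1n mulr1 -eE; apply: le_trans.
  by rewrite lerD2l lerN2 mulrC ler_pM2l// eE expr2 ler_piMl// ltW.
have up : H <= x + 5 / ln 2 * v.
  apply: (le_trans H_le).
  rewrite natrM lnM ?posrE ?ltr0n ?expn_gt0// ln2s natrX lnXn// -/M -mulr_natl lne.
  (* Two of the four [ln M] come from the pair of keys and two from [- ln e]; the constant 5 comes
     from [1 + 4 * ln M <= 5 * M]. *)
  rewrite [leLHS](_ : _ = e * s%:R + e * (1 + 4 * ln M) / ln 2); last first.
    by field; rewrite gt_eqF.
  apply: lerD; first exact: es_le.
  rewrite [leRHS]mulrAC ler_pM2r ?invr_gt0//.
  have -> : 5 * v = v ^+ 2 * (5 * M) by rewrite expr2 -[LHS]mulr1 -vM; ring.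
  by rewrite eE ler_wpM2l ?sqr_ge0//; lra.
(* Truncation costs at most [2 * v], and the factor [k / M = 1 - v] at most [v * x]. *)
have low : x - 2 * v - v * x <= H.
  apply: le_trans H_ge; rewrite kM ln2s mulfK ?gt_eqF//.
  have -> : e * (1 - v) * s%:R = e * s%:R - v * (e * s%:R) by ring.
  by rewrite lerB// ler_wpM2l// ltW.
have c0 : 0 <= 5 / ln 2 * v by rewrite mulr_ge0 ?divr_ge0// ltW.
have xv0 : 0 <= v * x by rewrite mulr_ge0// ltW.
rewrite ler_distlC -/v !mulrDl (mulrC x); lra.
Qed.

Theorem theorem7 (R : realType) : coneC R `<=` closure (entropy_vectors R).
Proof.
move=> [[x y] z] [] /= x0 [y0 [z0 zxy]] U /nbhs_ballP[r r0 rU].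
have ln2 : 0 < ln (2 : R) by rewrite ln_gt0// ltr1n.
pose C : R := x + y + z + 2 + 5 / ln 2.
have c0 : 0 < 5 / ln 2 :> R by rewrite divr_gt0.
(* This makes [M] exceed [C / r], where [C] dominates the error constants of all three
   coordinates. *)
pose k := Num.truncn (C / r).
pose M : R := k.+1%:R.
have M0 : 0 < M by rewrite ltr0n.
have CM t : t <= x + y + z -> (t + 2 + 5 / ln 2) / M < r.
  move=> tC; rewrite ltr_pdivrMr// -ltr_pdivrMl//.
  apply: le_lt_trans (truncnS_gt (C / r)); rewrite mulrC ler_pM2r ?invr_gt0//.
  by rewrite /C; lra.
pose e : R := (M ^+ 2)^-1.
have e0 : 0 < e by rewrite invr_gt0 exprn_gt0.
have e1 : e <= 1 by rewrite invf_le1 ?exprn_gt0// exprn_ege1// ler1n.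
have e01 : 0 < e <= 1 by rewrite e0.
have M2 : 0 <= M ^+ 2 by rewrite sqr_ge0.
(* With [z1] as large as possible, [z <= x + y] gives [z2 <= y]. *)
pose z1 := Num.min x z; pose z2 := z - z1.
have z10 : 0 <= z1 by rewrite le_min x0.
have z1x : z1 <= x by rewrite ge_min lexx.
have z20 : 0 <= z2 by rewrite subr_ge0 ge_min lexx orbT.
have z2y : z2 <= y by rewrite /z2 /z1; case: (leP x z); lra.
pose N t := Num.truncn (t * M ^+ 2).
have NP s t : 0 <= s -> 0 <= t ->
    (s + t) * M ^+ 2 - 2 <= (N s + N t)%:R <= (s + t) * M ^+ 2.
  move=> s0 t0; have /andP[? +] := truncn_itv (mulr_ge0 s0 M2).
  have /andP[? +] := truncn_itv (mulr_ge0 t0 M2).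
  by rewrite -!natr1 natrD mulrDl /N; lra.
pose GX : finType := 'I_(2 ^ N z1); pose DX : finType := 'I_(2 ^ N (x - z1)).
pose GY : finType := 'I_(2 ^ N z2); pose DY : finType := 'I_(2 ^ N (y - z2)).
have pow0 n : (0 < #|'I_(2 ^ n)|)%N by rewrite card_ord expn_gt0.
pose p := diluted (R := R) (@joint k GX DX GY DY) e.
have card2 m n : (#|'I_(2 ^ m)| * #|'I_(2 ^ n)|)%N = (2 ^ (m + n))%N.
  by rewrite !card_ord expnD.
exists (meas_entropy (margX p), meas_entropy (margY p), meas_entropy p); split.
  exists 2, 2, _, _, _, _, p; split=> //.
  by apply: joint_state => //; exact: pow0.
have eX : meas_entropy (margX p) = meas_entropy (diluted (@party_secret k GX DX) e).
  by rewrite /p margX_diluted// card_prod muln_gt0 !pow0.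
have eY : meas_entropy (margY p) = meas_entropy (diluted (@party_secret k GY DY) e).
  by rewrite /p margY_diluted// card_prod muln_gt0 !pow0.
apply: rU; split; first split; rewrite /= -ball_normE /=.
- rewrite eX; apply: le_lt_trans (CM x _); last by lra.
  have := party_entropy_ge k e01 (pow0 (N z1)) (pow0 (N (x - z1))).
  have := party_entropy_le k e01 (pow0 (N z1)) (pow0 (N (x - z1))).
  rewrite !card2 => le ge; apply: entropy_error ge le => //.
  by have := NP z1 (x - z1); rewrite subrKC; apply; rewrite ?subr_ge0.
- rewrite eY; apply: le_lt_trans (CM y _); last by lra.
  have := party_entropy_ge k e01 (pow0 (N z2)) (pow0 (N (y - z2))).
  have := party_entropy_le k e01 (pow0 (N z2)) (pow0 (N (y - z2))).
  rewrite !card2 => le ge; apply: entropy_error ge le => //.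
  by have := NP z2 (y - z2); rewrite subrKC => /(_ z20); apply; rewrite subr_ge0.
have zr : (z + 2 + 5 / ln 2) / M < r by apply: CM; lra.
apply: le_lt_trans zr.
have := @joint_entropy_ge R k GX DX GY DY e e01 (pow0 _) (pow0 _) (pow0 _) (pow0 _).
have := @joint_entropy_le R k GX DX GY DY e e01 (pow0 _) (pow0 _) (pow0 _) (pow0 _).
rewrite !card2 => le ge; apply: entropy_error le => //.
  by have := NP z1 z2; rewrite /z2 subrKC; apply.
(* The joint bound is weakened by the factor [k / M <= 1] to fit [entropy_error]. *)
apply: le_trans ge; rewrite -mulrA ler_pM2l// ler_piMl//.
  by rewrite divr_ge0 ?(ltW ln2)// ln_ge0// ler1n expn_gt0.
by rewrite ler_pdivrMr// mul1r ler_nat.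
Qed.
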